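(* Let $n\ge2$, let $\Sigma^+=\{1,\dots,n\}^{\mathbb N}$, and let $\bar w\in\Sigma^+$ be a periodic word of period $p\in\mathbb N$. For every $c\in\mathbb N$, $$\dim(S_{\bar w}(c))\ \le\ \log(n)-\frac{|\log(1-n^{-c})|}{c},$$ as well as $$\dim(S_{\bar w}(2c+p+1))\ \ge\ \log(n)-\frac{|\log(1-n^{-c})|}{c}.$$
   Context: $\mathbb N=\{1,2,\dots\}$. $T$ is the shift on $\Sigma^+$, and $\Sigma^+$ carries the metric $d^+(w,w')=e^{-\min\{i\ge1:\,w(i)\ne w'(i)\}}$ for $w\ne w'$, $d^+(w,w)=0$. $\dim$ denotes Hausdorff dimension with respect to $d^+$ and $B(w,r)=\{w'\in\Sigma^+:d^+(w,w')\le r\}$. For $c\in\mathbb N$, $$S_{\bar w}(c)=\{w\in\Sigma^+:\ T^kw\notin B(\bar w,e^{-(c+1)})\ \text{for all }k\in\mathbb N\}.$$ *)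

(* Defs.v *)
From HB Require Import structures.
From mathcomp Require Import all_boot all_order all_algebra.
From mathcomp Require Import all_classical all_reals all_analysis.

Set Implicit Arguments.
Unset Strict Implicit.
Unset Printing Implicit Defensive.

Import Order.TTheory GRing.Theory Num.Theory.

Local Open Scope classical_set_scope.
Local Open Scope ring_scope.

Section Hausdorff.
Context {R : realType} {T : metricType R}.
Implicit Types (A U : set T) (s delta : R).

Definition cball (x : T) (r : R) : set T := [set y | mdist x y <= r].

(* [diam set0 = -oo]; the empty set is handled separately in [gauge]. *)
Definition diam U : \bar R :=
  ereal_sup [set (mdist x y)%:E | x in U & y in U].

(* [diam U ^ s], where the empty set contributes 0 even for [s = 0]
   (for nonempty [U] one has [0 `^ 0 = 1]). *)
Definition gauge s U : \bar R :=
  if U == set0 then 0%E else (diam U `^ s)%E.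

Definition hausdorff_premeasure s delta A : \bar R :=
  ereal_inf [set (\sum_(0 <= k <oo) gauge s (U k))%E | U in
    [set U : nat -> set T | A `<=` \bigcup_k U k /\
       forall k, (diam (U k) <= delta%:E)%E]].

Definition hausdorff_measure s A : \bar R :=
  ereal_sup [set hausdorff_premeasure s delta A | delta in
    [set delta : R | 0 < delta]].

Definition hausdorff_dim A : \bar R :=
  ereal_inf [set s%:E | s in
    [set s : R | 0 <= s /\ hausdorff_measure s A = 0%E]].

End Hausdorff.

(* One-sided infinite words over an alphabet of [n] letters.  The coordinate
   w(i), i >= 1, of the mathematical notation is [w i.-1].  The parameter [R]
   is the field in which the metric takes its values. *)
Definition word (R : realType) (n : nat) : Type := nat -> 'I_n.

HB.instance Definition _ (R : realType) (n : nat) :=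
  gen_eqMixin (word R n).
HB.instance Definition _ (R : realType) (n : nat) :=
  gen_choiceMixin (word R n).

Section WordMetric.
Context {R : realType} {n : nat}.
Implicit Types u v w : word R n.

(* min {i >= 1 : w(i) <> w'(i)}, with the junk value 0 if the words agree. *)
Definition first_diff w w' : nat :=
  if pselect (exists k, w k != w' k) is left h then (ex_minn h).+1 else 0%N.

Definition word_dist w w' : R :=
  if w == w' then 0 else expR (- (first_diff w w')%:R).

Lemma word_neqP w w' : w != w' -> exists k, w k != w' k.
Proof.
move=> /eqP ww'; apply: contrapT => h; apply: ww'; apply/funext => k.
by apply/eqP; apply: contrapT => /negP wk; apply: h; exists k.
Qed.

Lemma first_diff_min w w' k : (k.+1 < first_diff w w')%N -> w k = w' k.
Proof.
rewrite /first_diff; case: pselect => // h; case: ex_minnP => m _ hmin.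
by rewrite ltnS => km; apply/eqP; apply: contraTT km => /hmin; rewrite -leqNgt.
Qed.

Lemma first_diff_neq w w' : w != w' ->
  exists2 m, first_diff w w' = m.+1 & w m != w' m.
Proof.
move=> /word_neqP ww'; rewrite /first_diff; case: pselect => // h.
by case: ex_minnP => m wm _; exists m.
Qed.

Lemma first_diffC w w' : first_diff w w' = first_diff w' w.
Proof.
have [->//|ww'] := eqVneq w w'.
have [m em dm] := first_diff_neq ww'.
have w'w : w' != w by rewrite eq_sym.
have [m' em' dm'] := first_diff_neq w'w.
rewrite em em'; case: (ltngtP m m') => [mm'|mm'|->//].
- by move: dm; rewrite (@first_diff_min w' w m) ?eqxx// em' ltnS.
- by move: dm'; rewrite (@first_diff_min w w' m') ?eqxx// em ltnS.
Qed.

Lemma word_distxx w : word_dist w w = 0.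
Proof. by rewrite /word_dist eqxx. Qed.

Lemma word_dist_positivity w w' : word_dist w w' = 0 -> w = w'.
Proof.
by rewrite /word_dist; case: eqVneq => // _ /eqP; rewrite gt_eqF ?expR_gt0.
Qed.

Lemma word_distC w w' : word_dist w w' = word_dist w' w.
Proof. by rewrite /word_dist eq_sym first_diffC. Qed.

Lemma word_dist_ge0 w w' : 0 <= word_dist w w'.
Proof. by rewrite /word_dist; case: ifP => // _; exact: expR_ge0. Qed.

Lemma word_dist_triangle v u w :
  word_dist u w <= word_dist u v + word_dist v w.
Proof.
have [->|uw] := eqVneq u w; first by rewrite word_distxx addr_ge0 ?word_dist_ge0.
have [->|uv] := eqVneq u v; first by rewrite word_distxx add0r.
have [->|vw] := eqVneq v w; first by rewrite word_distxx addr0.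
have [m em dm] := first_diff_neq uw.
have : (first_diff u v <= m.+1)%N || (first_diff v w <= m.+1)%N.
  rewrite leqNgt (leqNgt (first_diff v w)) -negb_and; apply/negP => /andP[a b].
  by move: dm; rewrite (first_diff_min a) (first_diff_min b) eqxx.
rewrite {1}/word_dist (negbTE uw) em => /orP[h|h].
- rewrite ler_wpDr ?word_dist_ge0// /word_dist (negbTE uv).
  by rewrite ler_expR lerN2 ler_nat.
- rewrite ler_wpDl ?word_dist_ge0// /word_dist (negbTE vw).
  by rewrite ler_expR lerN2 ler_nat.
Qed.

HB.instance Definition _ := @isMetric.Build R (word R n) word_dist
  word_distxx word_dist_positivity word_distC word_dist_triangle.

Definition word_shift w : word R n := fun k => w k.+1.

(* Iterates range over k >= 1, so w itself may lie in the ball. *)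
Definition avoid_set (wbar : word R n) (c : nat) : set (word R n) :=
  [set w | forall k, (0 < k)%N ->
     ~ cball wbar (expR (- (c + 1)%:R)) (iter k word_shift w)].

End WordMetric.

(* Main.v *)
(* Write [a_N] for the number of words of length [N] without a factor [u], and
   let [d] be the claimed exponent, so that [expR d ^+ c = n ^ c - 1].

   Upper bound: a word of [avoid_set wbar c] is a letter followed by blocks of
   length [c], none of which is the prefix [wbar(1) ... wbar(c)].  This leaves
   [n (n ^ c - 1) ^ m] cylinders of depth [m c + 1].

   Lower bound: let [u] be the prefix of [wbar] of length [2 c + p + 1] and
   [lam = expR d].  A one-letter extension of a [u]-free word is [u]-free unless
   it ends in [u], so [n a_N <= a_(N+1) + a_(N+1-|u|)]; since
   [1 <= (n - lam) lam ^ (|u| - 1)], it follows that [lam a_N <= a_(N+1)].  If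
   finitely many cylinders [v_i] cover the [u]-free words, then counting those
   of a large length [M] gives [a_M <= \sum_i a_(M-|v_i|)
   <= a_M \sum_i lam ^ (-|v_i|)], i.e. the mass distribution principle for the
   uniform distribution on [u]-free words of length [M].  Compactness reduces
   countable covers to this case. *)
Require Import Defs.
From mathcomp Require Import all_boot all_order all_algebra.
From mathcomp Require Import all_classical all_reals all_analysis.
From mathcomp Require Import zify ring lra.
Import Order.TTheory GRing.Theory Num.Theory.
Local Open Scope classical_set_scope.
Local Open Scope ring_scope.

(** * Counting words that avoid a factor *)

Section FactorFreeWords.
Local Open Scope nat_scope.
Context {A : finType}.
Implicit Types (u v s : seq A) (N k M : nat).

Definition free_words u N : seq (seq A) :=
  [seq s <- [seq val t | t <- enum {: N.-tuple A}] | ~~ infix u s].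

Lemma mem_free_words u N s :
  (s \in free_words u N) = (size s == N) && ~~ infix u s.
Proof.
rewrite mem_filter andbC; congr (_ && _).
apply/mapP/idP => [[t _ ->]|sN]; first by rewrite size_tuple.
by exists (Tuple sN); rewrite ?mem_enum.
Qed.

Lemma free_words_uniq u N : uniq (free_words u N).
Proof. by rewrite filter_uniq// map_inj_uniq ?enum_uniq//; exact: val_inj. Qed.

Lemma size_free_words0 u : u != [::] -> size (free_words u 0) = 1.
Proof.
move=> u0; suff /perm_size : perm_eq (free_words u 0) [:: [::]] by [].
apply: uniq_perm => [||s]; rewrite ?free_words_uniq// mem_free_words size_eq0 inE.
by have [->|] := eqVneq s [::]; rewrite ?infixs0 ?u0.
Qed.

(** The word [u] has the right length but is missing from the list; this is the source of the [- 1]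
    in [n ^ c - 1]. *)
Lemma size_free_words_self u : size (free_words u (size u)) < #|A| ^ size u.
Proof.
have <- : size [seq val t | t <- enum {: (size u).-tuple A}] = #|A| ^ size u.
  by rewrite size_map -cardE card_tuple.
rewrite -[X in X <= _]/(size (u :: free_words u (size u))).
apply: uniq_leq_size => [/=|s].
  by rewrite free_words_uniq mem_free_words infix_refl andbF.
rewrite inE => /orP[/eqP->|]; last by rewrite mem_filter => /andP[].
by apply/mapP; exists (in_tuple u); rewrite ?mem_enum.
Qed.

Lemma size_rcons_free_words u N :
  size [seq rcons s a | s <- free_words u N, a <- enum A] =
  size (free_words u N) * #|A|.
Proof. by rewrite size_allpairs cardE. Qed.

Lemma rcons_free_words_uniq u N :
  uniq [seq rcons s a | s <- free_words u N, a <- enum A].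
Proof.
apply: allpairs_uniq; rewrite ?free_words_uniq ?enum_uniq//.
by move=> [s a] [s' a'] _ _ /= /rcons_inj.
Qed.

Lemma free_words_growth_short u N : N.+1 < size u ->
  size (free_words u N) * #|A| <= size (free_words u N.+1).
Proof.
move=> Nu; rewrite -size_rcons_free_words.
apply: uniq_leq_size (rcons_free_words_uniq _ _) _ => _ /allpairsP[[s a] /= [+ _ ->]].
rewrite !mem_free_words size_rcons => /andP[/eqP sN _]; rewrite sN eqxx/=.
by apply: contraTN Nu => /size_infix; rewrite size_rcons sN -leqNgt.
Qed.

(* Appending a letter to a [u]-free word can only create an occurrence of [u]
   as a suffix, and what precedes that suffix is again [u]-free. *)
Lemma free_words_growth u N : u != [::] -> size u <= N.+1 ->
  size (free_words u N) * #|A| <=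
  size (free_words u N.+1) + size (free_words u (N.+1 - size u)).
Proof.
move=> u0 uN; rewrite -size_rcons_free_words.
(* The second summand counts the words [t ++ u]. *)
rewrite -[X in _ + X](size_map (cat^~ u)) -size_cat.
apply: uniq_leq_size (rcons_free_words_uniq _ _) _ => _ /allpairsP[[s a] /= [+ _ ->]].
rewrite mem_cat !mem_free_words size_rcons => /andP[/eqP sN us].
rewrite sN eqxx/= infix_rconsl (negbTE us) orbF.
have [/suffixP[t st]|//] := boolP (suffix u (rcons s a)).
rewrite st/= (map_f (cat^~ u)) // mem_free_words.
have -> : size t = N.+1 - size u.
  by have := congr1 size st; rewrite size_rcons size_cat sN => ->; rewrite addnK.
(* An occurrence of [u] in [t] would lie in [s], since [s] is [t ++ u] without its last letter. *)
rewrite eqxx/=; apply: contra us => ut.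
have [u' [b ub]] : exists u' b, u = rcons u' b.
  by case: (lastP u) u0 => // u' b _; exists u', b.
move: st; rewrite {1}ub -rcons_cat => /rcons_inj[-> _].
exact: infix_catr.
Qed.

(** Behind a prefix [v], a [u]-free word of length [M] continues with a [u]-free word of length
    [M - size v]. A [v] longer than [M] is a prefix of none and only enlarges the sum. *)
Lemma free_words_cover u M (vs : seq (seq A)) :
  {in free_words u M, forall s, has (fun v => prefix v s) vs} ->
  size (free_words u M) <= \sum_(v <- vs) size (free_words u (M - size v)).
Proof.
move=> vsP; pose ext v := [seq v ++ s | s <- free_words u (M - size v)].
have -> : \sum_(v <- vs) size (free_words u (M - size v)) =
    size (flatten [seq ext v | v <- vs]).
  rewrite size_flatten /shape -map_comp sumnE big_map.
  by apply: eq_bigr => v _; rewrite /= size_map.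
apply: uniq_leq_size (free_words_uniq _ _) _ => s sM.
have /hasP[v vvs /prefixP[t st]] := vsP s sM.
apply/flattenP; exists (ext v); first exact: map_f.
move: sM; rewrite st mem_free_words => /andP[/eqP + ut].
rewrite size_cat => sizeM; apply: map_f.
by rewrite mem_free_words -sizeM addKn eqxx; apply: contra ut => /(infix_catl v).
Qed.

(* Koenig's lemma for the tree of [u]-free words. *)
Lemma free_words_compact u (v : nat -> seq A) :
  (forall x : nat -> A, (forall N, ~~ infix u (mkseq x N)) ->
     exists i, v i = mkseq x (size (v i))) ->
  exists M, {in free_words u M, forall s, exists i,
    [/\ i < M, size (v i) <= M & prefix (v i) s]}.
Proof.
move=> vx; apply: contrapT => nM.
(* Both bounds, on [i] and on [size (v i)], grow with the level, so [uncovered] passes to prefixes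
   and defines a tree; [alive] words have descendants at every level from their own on. *)
pose uncovered M s := s \in free_words u M /\
  forall i, i < M -> size (v i) <= M -> ~~ prefix (v i) s.
pose alive s := forall M, size s <= M -> exists2 t, prefix s t & uncovered M t.
have uncovered_take M N s : N <= M -> uncovered M s -> uncovered N (take N s).
  move=> NM [sM sP]; move: (sM); rewrite mem_free_words => /andP[/eqP sizes us].
  split.
    rewrite mem_free_words size_takel ?sizes ?eqxx//=.
    by apply: contra us => /infix_prefix_trans; apply; exact: prefix_take.
  move=> i iN viN; apply: contra (sP i _ _); last 2 first.
    exact: leq_trans iN NM.
    exact: leq_trans viN NM.
  by move=> /prefix_trans; apply; exact: prefix_take.
have alive0 : alive [::].
  move=> M _; apply: contrapT => nt; apply: nM; exists M => s sM.
  apply: contrapT => ns; apply: nt; exists s; first exact: prefix0s.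
  split=> // i iM viM; apply/negP => vis; apply: ns; exists i; split => //.
have alive_rcons s : alive s -> exists a, alive (rcons s a).
  move=> sP; apply: contrapT => na.
  have {}na a : exists M, size s < M /\
      forall t, prefix (rcons s a) t -> ~ uncovered M t.
    apply: contrapT => nMa; apply: na; exists a => M; rewrite size_rcons => sM.
    apply: contrapT => nt; apply: nMa; exists M; split => // t st Mt.
    by apply: nt; exists t.
  have [B BP] := choice na.
  (* If each [rcons s a] is without descendants at level [B a], then [s] has none at level [M]; the
     maximum exists because the alphabet is finite. *)
  pose M := maxn (size s).+1 (\max_(a : A) B a).
  have [|t /prefixP[t' def_t] Mt] := sP M; first by rewrite leq_max leqnSn.
  have sizet : size t = M.
    by case: Mt; rewrite mem_free_words => /andP[/eqP].
  case: t' def_t => [|a t'] def_t.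
    have := leq_maxl (size s).+1 (\max_(a : A) B a).
    by rewrite -/M -sizet def_t cats0 ltnn.
  have BM : B a <= M by rewrite leq_max (leq_bigmax a) orbT.
  have [sB /(_ (take (B a) t))] := BP a.
  apply; last exact: uncovered_take BM Mt.
  by rewrite prefixE def_t -cat_rcons take_takel ?take_size_cat// size_rcons.
have [f fP] : {f : seq A -> A & forall s, alive s -> alive (rcons s (f s))}.
  apply: cid; have [a0|] := pselect (exists a : A, True); last first.
    by move=> nA; have [a _] := alive_rcons _ alive0; case: nA; exists a.
  case: a0 => a0 _.
  have /choice[f fP] : forall s, exists a, alive s -> alive (rcons s a).
    move=> s; have [/alive_rcons[a aP]|ns] := pselect (alive s); first by exists a.
    by exists a0.
  by exists f.
pose br := fix br k := if k is k'.+1 then rcons (br k') (f (br k')) else [::].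
pose x k := f (br k).
have brE k : br k = mkseq x k.
  by elim: k => //= k IHk; rewrite mkseqS -IHk.
have br_alive k : alive (br k) by elim: k => //= k; exact: fP.
have uncovered_br k : uncovered k (mkseq x k).
  rewrite -brE; have [|t st [tk tP]] := br_alive k k; first by rewrite brE size_mkseq.
  suff -> : br k = t by [].
  move: tk st; rewrite mem_free_words prefixE brE size_mkseq => /andP[/eqP <- _].
  by rewrite take_size => /eqP.
have [|i vi] := vx x.
  by move=> N; have [+ _] := uncovered_br N; rewrite mem_free_words => /andP[].
(* At this level both the index and the length of [v i] are in range, yet [v i] is a prefix of the
   branch. *)
pose M := maxn i.+1 (size (v i)).
have [_ /(_ i)] := uncovered_br M; rewrite leq_maxl leq_maxr => /(_ isT isT)/negP; apply.
by rewrite {1}vi prefixE size_mkseq -map_take take_iota (minn_idPl _)// leq_maxr.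
Qed.

End FactorFreeWords.

(** * Exponential growth of the number of factor-free words *)

Section GrowthRate.
Context {R : realType}.

(** Growth is assumed only below [N], so that this applies inside a strong induction on [N]. *)
Lemma geometric_growth_iter (f : nat -> R) (lam : R) N k : 0 <= lam ->
  (forall j, (j < N)%N -> lam * f j <= f j.+1) -> (k <= N)%N ->
  lam ^+ k * f (N - k)%N <= f N.
Proof.
move=> lam0 fN; elim: k => [|k IHk] kN; first by rewrite expr0 mul1r subn0.
apply: le_trans (IHk (ltnW kN)); rewrite exprSr -mulrA ler_wpM2l ?exprn_ge0//.
by rewrite -(subnSK kN) fN//; lia.
Qed.

Context {A : finType} (u : seq A) (lam : R).
Hypotheses (u0 : u != [::]) (lam1 : 1 <= lam).
Hypothesis lamP : 1 <= (#|A|%:R - lam) * lam ^+ (size u).-1.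
Notation a N := ((size (free_words u N))%:R : R).

Lemma free_words_growth_rate N : lam * a N <= a N.+1.
Proof.
have lam0 : 0 < lam by exact: lt_le_trans lam1.
have lamA : 0 <= #|A|%:R - lam.
  by rewrite -(pmulr_lge0 _ (exprn_gt0 (size u).-1 lam0)) (le_trans _ lamP).
have sizeu : (0 < size u)%N by rewrite lt0n size_eq0.
elim/ltn_ind: N => N IH; have [Nu|uN] := ltnP N.+1 (size u).
  apply: (@le_trans _ _ (#|A|%:R * a N)).
    by rewrite ler_wpM2r// -subr_ge0.
  by rewrite mulrC -natrM ler_nat free_words_growth_short.
have := free_words_growth _ _ u0 uN; rewrite -(ler_nat R) natrM natrD => grow.
(* The iterated induction hypothesis bounds [lam ^+ (size u).-1 * a (N.+1 - size u)] by [a N]; with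
   [lamP], the loss term in [grow] is at most [(#|A|%:R - lam) * a N]. *)
have := @geometric_growth_iter (fun N => a N) lam N (size u).-1 (ltW lam0) IH.
rewrite -ltnS prednK// => /(_ uN) /=.
have -> : (N - (size u).-1 = N.+1 - size u)%N by lia.
move=> /(ler_wpM2l lamA); rewrite mulrA => le1.
have /(ler_wpM2r (ler0n R (size (free_words u (N.+1 - size u))))) := lamP.
lra.
Qed.

Lemma free_words_cover_weight M (vs : seq (seq A)) :
  all (fun v => size v <= M)%N vs ->
  {in free_words u M, forall s, has (fun v => prefix v s) vs} ->
  1 <= \sum_(v <- vs) lam ^- size v.
Proof.
move=> vsM vsP; have lam0 : 0 < lam by exact: lt_le_trans lam1.
have aiter k : (k <= M)%N -> a (M - k)%N <= lam ^- k * a M.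
  move=> kM; rewrite ler_pdivlMl ?exprn_gt0//.
  apply: (@geometric_growth_iter (fun N => a N)) => //; first exact: ltW.
  by move=> j _; exact: free_words_growth_rate.
(* Growth is traced back to length 0, where the empty word is counted. *)
have aM : 0 < a M.
  have := aiter M (leqnn M); rewrite subnn size_free_words0// => h.
  have : 0 < lam ^- M * a M by apply: lt_le_trans h.
  by rewrite pmulr_rgt0// invr_gt0 exprn_gt0.
rewrite -(ler_pM2r aM) mul1r mulr_suml.
have := free_words_cover _ _ _ vsP; rewrite -(ler_nat R) natr_sum => /le_trans; apply.
rewrite big_seq [leRHS]big_seq; apply: ler_sum => v /(allP vsM); exact: aiter.
Qed.

End GrowthRate.

(** * Gauges and covers for Hausdorff measure *)

Section Gauge.
Context {R : realType} {T : metricType R}.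
Implicit Types (U A : set T) (s : R) (x y : T).

Lemma gauge_ge0 s U : (0 <= gauge s U)%E.
Proof. by rewrite /gauge; case: ifP => // _; exact: poweR_ge0. Qed.

Lemma mdist_le_diam U x y : U x -> U y -> ((mdist x y)%:E <= diam U)%E.
Proof. by move=> Ux Uy; apply: ereal_sup_ubound; exists x => //; exists y. Qed.

Lemma gauge_le s U d : 0 <= s -> (diam U <= d%:E)%E -> (gauge s U <= (d `^ s)%:E)%E.
Proof.
move=> s0 Ud; rewrite /gauge; case: ifPn => [_|/set0P[x Ux]].
  by rewrite lee_fin powR_ge0.
have U0 : (0 <= diam U)%E.
  by rewrite (le_trans _ (mdist_le_diam _ _ _ Ux Ux))// lee_fin mdist_ge0.
rewrite -poweR_EFin gt0_ler_poweR// in_itv/= ?leey ?U0//.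
by rewrite (le_trans U0 Ud).
Qed.

Lemma gauge_ge s U x y : 0 <= s -> U x -> U y ->
  ((mdist x y `^ s)%:E <= gauge s U)%E.
Proof.
move=> s0 Ux Uy; rewrite /gauge ifF; last by apply/negP => /eqP U0; rewrite U0 in Ux.
have d0 : (0 <= (mdist x y)%:E)%E by rewrite lee_fin mdist_ge0.
have xyU := mdist_le_diam _ _ _ Ux Uy.
by rewrite -poweR_EFin gt0_ler_poweR// in_itv/= ?leey ?d0// (le_trans d0 xyU).
Qed.

Lemma hausdorff_premeasure_ge0 s d A : (0 <= hausdorff_premeasure s d A)%E.
Proof.
by apply/ereal_infP => _ [U _ <-]; apply: nneseries_ge0 => k _ _; exact: gauge_ge0.
Qed.

Lemma hausdorff_premeasure_le s d A : 0 < d ->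
  (hausdorff_premeasure s d A <= hausdorff_measure s A)%E.
Proof. by move=> d0; apply: ereal_sup_ubound; exists d. Qed.

Lemma hausdorff_premeasure_finite_cover s d r A (Us : seq (set T)) :
  0 <= s -> 0 <= r -> r <= d -> (forall x, A x -> exists2 U, U \in Us & U x) ->
  {in Us, forall U, diam U <= r%:E}%E ->
  (hausdorff_premeasure s d A <= ((size Us)%:R * r `^ s)%:E)%E.
Proof.
(* The list is padded with [set0]: its diameter is [-oo] and its gauge 0, even for [s = 0]. *)
move=> s0 r0 rd AUs Usd; pose U k := nth set0 Us k.
have diam0 : diam (set0 : set T) = -oo%E.
  by rewrite /diam; apply/eqP; rewrite -leeNy_eq; apply/ereal_supP => y [x []].
have diamU k : (diam (U k) <= r%:E)%E.
  rewrite /U; have [kUs|kUs] := ltnP k (size Us); first exact/Usd/mem_nth.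
  by rewrite nth_default// diam0 leNye.
apply: (@le_trans _ _ (\sum_(0 <= k <oo) gauge s (U k))%E).
  apply: ereal_inf_lbound; exists U => //; split.
    move=> x /AUs[V VUs Vx]; exists (index V Us) => //.
    by rewrite /U nth_index.
  by move=> k; rewrite (le_trans (diamU k))// lee_fin.
rewrite (nneseries_split _ (size Us)); last by move=> k _; exact: gauge_ge0.
rewrite add0n [X in (_ + X)%E]eseries0 ?adde0; last first.
  by move=> i Usi _; rewrite /U nth_default// /gauge eqxx.
apply: (@le_trans _ _ (\sum_(0 <= k < size Us) (r `^ s)%:E)%E).
  by apply: lee_sum => k _; exact: gauge_le.
by rewrite sumEFin lee_fin big_const_nat iter_addr addr0 subn0 mulr_natl.
Qed.

End Gauge.

(** * Cylinders and avoiding words *)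

Section Words.
Context {R : realType} {n : nat}.
Implicit Types (w x : word R n) (v : seq 'I_n).

(** Differences are counted from 1, so words sharing exactly [m] initial letters are at distance
    [expR (- m.+1%:R)]; closed balls of this radius are cylinders of depth [m]. *)
Lemma word_dist_leP w w' m :
  word_dist w w' <= expR (- m.+1%:R) <-> mkseq w m = mkseq w' m.
Proof.
have mkseqP : mkseq w m = mkseq w' m <-> forall i, (i < m)%N -> w i = w' i.
  split=> [/eq_in_map ww' i im|ww']; first by rewrite ww'// mem_iota.
  by apply/eq_in_map => i; rewrite mem_iota; exact: ww'.
rewrite mkseqP; have [->|ww'] := eqVneq w w'.
  by rewrite word_distxx; split=> // _; exact: expR_ge0.
have [k ek wk] := first_diff_neq ww'.
rewrite /word_dist (negbTE ww') ek ler_expR lerN2 ler_nat ltnS; split=> [mk i im|h].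
  by apply: first_diff_min; rewrite ek ltnS (leq_trans im).
by rewrite leqNgt; apply/negP => /h /eqP; rewrite (negbTE wk).
Qed.

Definition cylinder v : set (word R n) := [set w | mkseq w (size v) = v].

Lemma cylinder_mkseqP w w' m :
  cylinder (mkseq w m) w' <-> mkseq w' m = mkseq w m.
Proof. by rewrite /cylinder /mkset size_mkseq. Qed.

Lemma diam_cylinder v : (diam (cylinder v) <= (expR (- (size v).+1%:R))%:E)%E.
Proof.
apply/ereal_supP => _ [w wv [w' w'v <-]]; rewrite lee_fin.
by apply/word_dist_leP; rewrite wv w'v.
Qed.

Lemma mkseq_iter_shift k m w :
  mkseq (iter k word_shift w) m = drop k (mkseq w (k + m)).
Proof.
rewrite /mkseq iotaD map_cat drop_size_cat ?size_map ?size_iota//.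
have -> : iota (0 + k) m = map (addn k) (iota 0 m) by rewrite -iotaDl addn0.
rewrite -map_comp; apply: eq_map => i /=.
by elim: k i => //= k IHk i; rewrite {1}/word_shift IHk addSnnS.
Qed.

Lemma mkseqD_shift k m w :
  mkseq w (k + m) = mkseq w k ++ mkseq (iter k word_shift w) m.
Proof.
rewrite mkseq_iter_shift -[LHS](cat_take_drop k); congr (_ ++ _).
by rewrite -map_take take_iota (minn_idPl _)// leq_addr.
Qed.

Lemma avoid_setP wbar c w : avoid_set wbar c w <->
  forall k, (0 < k)%N -> mkseq wbar c != mkseq (iter k word_shift w) c.
Proof.
suff ballP k : cball wbar (expR (- (c + 1)%:R)) (iter k word_shift w) <->
    mkseq wbar c = mkseq (iter k word_shift w) c.
  by split=> h k k0; [apply/eqP => /ballP; exact: h|move=> /ballP/eqP; exact/negP/h].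
by rewrite addn1; exact: word_dist_leP.
Qed.

(** Only an inclusion: freeness also forbids an occurrence at position 0, where [avoid_set] imposes
    nothing. *)
Lemma free_words_avoid wbar c w :
  (forall N, ~~ infix (mkseq wbar c) (mkseq w N)) -> avoid_set wbar c w.
Proof.
move=> h; apply/avoid_setP => k _; apply: contra (h (k + c)%N) => /eqP ->.
by rewrite mkseq_iter_shift infix_drop.
Qed.

(** The leading letter is arbitrary because [avoid_set] starts at the first shift. Each block is any
    word of length [size u] other than [u]; occurrences across block boundaries are tolerated, which
    suffices for an upper bound. *)
Fixpoint block_words (u : seq 'I_n) m : seq (seq 'I_n) :=
  if m is m'.+1 then
    [seq v ++ b | v <- block_words u m', b <- free_words u (size u)]
  else [seq [:: a] | a <- enum 'I_n].

Lemma size_block_words u m :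
  size (block_words u m) = (n * size (free_words u (size u)) ^ m)%N.
Proof.
elim: m => [|m IHm]/=; first by rewrite size_map size_enum_ord expn0 muln1.
by rewrite size_allpairs IHm expnSr mulnA.
Qed.

Lemma size_in_block_words u m :
  {in block_words u m, forall v, size v = (m * size u).+1}.
Proof.
elim: m => [_ /mapP[a _ ->]//|m IHm _ /allpairsP[[v b]/= [vm + ->]]].
rewrite mem_free_words => /andP[/eqP sizeb _].
by rewrite size_cat IHm// sizeb mulSn addnC addnS.
Qed.

Lemma avoid_block_words wbar c w m : avoid_set wbar c w ->
  mkseq w (m * c).+1 \in block_words (mkseq wbar c) m.
Proof.
move=> /avoid_setP wc; elim: m => [|m IHm].
  by apply/mapP; exists (w 0%N); rewrite ?mem_enum.
have -> : (m.+1 * c).+1 = ((m * c).+1 + c)%N by lia.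
rewrite mkseqD_shift; apply: allpairs_f => //.
rewrite mem_free_words !size_mkseq eqxx/=; apply: contra (wc _ (ltn0Sn (m * c))).
(* A factor as long as the block is the whole block. *)
move=> /infixP[s [s' /[dup] e]]; move/(congr1 size); rewrite !size_cat !size_mkseq => sz.
have [s0 s'0] : size s = 0%N /\ size s' = 0%N by lia.
by rewrite e (size0nil s0) (size0nil s'0) cats0.
Qed.

End Words.

(** * Vanishing and non-vanishing of Hausdorff measure *)

Section Bounds.
Import numFieldNormedType.Exports.
Context {R : realType} {n : nat}.
Implicit Types (wbar x : word R n) (u : seq 'I_n) (s : R).

(** The [n * F ^ m] cylinders of depth [m * c + 1] have diameter at most [expR (- (m * c).+2%:R)],
    so their total gauge is at most [n * q ^ m], which tends to 0. *)
Lemma hausdorff_measure_avoid_eq0 wbar c s : (0 < c)%N -> 0 <= s ->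
  (size (free_words (mkseq wbar c) c))%:R * expR (- s) ^+ c < 1 ->
  hausdorff_measure s (avoid_set wbar c) = 0%E.
Proof.
move=> c0 s0; set F := size _; set q := _ * _ => q1.
have q0 : 0 <= q by rewrite mulr_ge0// exprn_ge0// expR_ge0.
apply/eqP; rewrite eq_le; apply/andP; split; last first.
  exact: le_trans (hausdorff_premeasure_ge0 s 1 _) (hausdorff_premeasure_le _ _ _ ltr01).
apply/ereal_supP => _ [d /= d0 <-]; apply/lee_addgt0Pr => e e0; rewrite add0e.
have cvgq : (fun m => n%:R * q ^+ m) @ \oo --> (0 : R).
  rewrite -[X in _ --> X](mulr0 n%:R); apply: cvgMl_tmp; apply: cvg_expr.
  by rewrite ger0_norm.
have cvgd : (fun m => expR (-1) ^+ m) @ \oo --> (0 : R).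
  by apply: cvg_expr; rewrite ger0_norm ?expR_ge0// expR_lt1 ltrN10.
near \oo => m.
pose r : R := expR (- (m * c).+2%:R).
have rd : r <= d.
  apply: (@le_trans _ _ (expR (-1) ^+ m)).
    rewrite -expRM_natl ler_expR mulrN1 lerN2 ler_nat.
    by rewrite (leq_trans _ (leqW (leqnSn _)))// leq_pmulr.
  by apply: ltW; near: m; exact: (cvgr_lt (0 : R)).
apply: le_trans (hausdorff_premeasure_finite_cover s d r _
  [seq cylinder v | v <- block_words (mkseq wbar c) m] s0 (expR_ge0 _) rd _ _) _.
- move=> w /(avoid_block_words _ _ _ m) wm; exists (cylinder (mkseq w (m * c).+1)).
    exact: map_f.
  exact/cylinder_mkseqP.
- move=> U /mapP[v vm ->]; apply: le_trans (diam_cylinder v) _.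
  by rewrite (size_in_block_words _ _ _ vm) size_mkseq.
rewrite lee_fin size_map size_block_words size_mkseq -/F.
apply: (@le_trans _ _ (n%:R * q ^+ m)); last first.
  by apply: ltW; near: m; exact: (cvgr_lt (0 : R)).
rewrite natrM natrX -mulrA ler_wpM2l// exprMn ler_wpM2l ?exprn_ge0//.
rewrite /r -expRM -exprM -expRM_natl ler_expR mulNr mulrN lerN2 ler_wpM2r//.
by rewrite ler_nat; lia.
Unshelve. all: by end_near. Qed.

(** If [U] has two points, take the least [m] such that two of them are at distance
    [expR (- m.+1%:R)]: all of [U] shares [m] letters, and the factor [expR s] pays for the offset
    between [m] and [m.+1]. Otherwise the gauge may vanish, and a cylinder of weight below [e] is
    used, along [x] if [U] is empty. *)
Lemma cylinder_cover x (U : set (word R n)) s lam e :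
  0 <= s -> expR s <= lam -> 1 < lam -> 0 < e ->
  exists v, U `<=` cylinder v /\
    ((lam ^- size v)%:E <= (expR s)%:E * gauge s U + e%:E)%E.
Proof.
move=> s0 slam lam1 e0; have lam0 : 0 < lam by exact: lt_trans lam1.
have [UP|U1] := pselect (exists y z, [/\ U y, U z & y != z]).
  have /ex_minnP[m /asboolP[y [z [Uy Uz yz]]] mmin] : exists m,
      `[< exists y z, [/\ U y, U z & mdist y z = expR (- m.+1%:R) :> R] >].
    have [y [z [Uy Uz yz]]] := UP; have [m em _] := first_diff_neq yz.
    exists m; apply/asboolP; exists y, z; split => //.
    by rewrite /mdist/= /word_dist (negbTE yz) em.
  exists (mkseq y m); split=> [w Uw|].
    apply/cylinder_mkseqP/word_dist_leP.
    have [->|wy] := eqVneq w y; first by rewrite word_distxx expR_ge0.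
    have [k ek _] := first_diff_neq wy.
    have ekE : word_dist w y = expR (- k.+1%:R) :> R.
      by rewrite /word_dist (negbTE wy) ek.
    rewrite ekE ler_expR lerN2 ler_nat ltnS; apply: mmin; apply/asboolP.
    by exists w, y.
  have := gauge_ge s U y z s0 Uy Uz; rewrite yz -expRM => gU.
  have : ((expR s)%:E * (expR (- m.+1%:R * s))%:E <= (expR s)%:E * gauge s U)%E.
    by rewrite lee_wpmul2l// lee_fin expR_ge0.
  move=> {}gU; apply: le_trans (leeDl _ _); last by rewrite lee_fin ltW.
  apply: le_trans gU; rewrite -EFinM lee_fin size_mkseq -expRD.
  have -> : s + - m.+1%:R * s = - (m%:R * s) by rewrite -natr1; ring.
  rewrite expRN expRM_natl lef_pV2 ?posrE ?exprn_gt0 ?expR_gt0//.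
  by rewrite lerXn2r ?nnegrE ?expR_ge0// ltW.
have [N Ne] : exists N, lam ^- N < e.
  have cvgl : (fun N => lam^-1 ^+ N) @ \oo --> (0 : R).
    by apply: cvg_expr; rewrite ger0_norm ?invr_ge0 ?ltW// invf_lt1.
  near \oo => N; exists N; rewrite -exprVn; near: N; exact: (cvgr_lt (0 : R)).
have vP v : size v = N ->
    ((lam ^- size v)%:E <= (expR s)%:E * gauge s U + e%:E)%E.
  move=> ->; apply: le_trans (leeDr _ _); first by rewrite lee_fin ltW.
  by rewrite mule_ge0 ?lee_fin ?expR_ge0 ?gauge_ge0.
have [[y Uy]|U0] := pselect (U !=set0).
  exists (mkseq y N); split; last by rewrite vP// size_mkseq.
  move=> w Uw; apply/cylinder_mkseqP; have [->//|wy] := eqVneq w y.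
  by case: U1; exists w, y.
exists (mkseq x N); split; last by rewrite vP// size_mkseq.
by move=> w Uw; case: U0; exists w.
Unshelve. all: by end_near. Qed.

(** These are the errors [e] granted to the sets of a countable cover. *)
Lemma sum_half_pow M : \sum_(0 <= i < M) (2^-1 : R) ^+ i.+2 < 2^-1.
Proof.
suff -> : \sum_(0 <= i < M) (2^-1 : R) ^+ i.+2 = 2^-1 - 2^-1 ^+ M.+1.
  by rewrite ltrBlDr ltrDl exprn_gt0// invr_gt0.
elim: M => [|M IHM]; first by rewrite big_geq// expr1 subrr.
by rewrite big_nat_recr//= IHM !exprS; lra.
Qed.

Lemma hausdorff_measure_free_words_neq0 x u s lam (A : set (word R n)) :
  u != [::] -> 0 <= s -> expR s <= lam -> 1 < lam ->
  1 <= (n%:R - lam) * lam ^+ (size u).-1 ->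
  (forall w, (forall N, ~~ infix u (mkseq w N)) -> A w) ->
  hausdorff_measure s A <> 0%E.
Proof.
move=> u0 s0 slam lam1 lamP uA sA0.
(* Multiplied by the [expR s] of [cylinder_cover], this threshold becomes one half; the errors add
   less than another half, so the total weight falls below 1, against [free_words_cover_weight]. *)
have : (hausdorff_premeasure s 1 A < (expR (- s) / 2)%:E)%E.
  apply: le_lt_trans (hausdorff_premeasure_le _ _ _ ltr01) _.
  by rewrite sA0 lte_fin divr_gt0// expR_gt0.
move=> /ereal_inf_ltP[_ [U [AU _] <-]] Us.
have /choice[v vP] : forall i, exists v, U i `<=` cylinder v /\
    ((lam ^- size v)%:E <= (expR s)%:E * gauge s (U i) + (2^-1 ^+ i.+2)%:E)%E.
  by move=> i; apply: cylinder_cover => //; rewrite exprn_gt0// invr_gt0.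
have [|M MP] := free_words_compact u v.
  move=> w /uA/AU[i _ Uiw]; exists i; apply/esym; exact: (vP i).1.
pose vs := [seq v i | i <- index_iota 0 M & (size (v i) <= M)%N].
have : 1 <= \sum_(w <- vs) lam ^- size w.
  apply: (@free_words_cover_weight _ _ u _ u0 (ltW lam1) _ M).
  - by rewrite card_ord.
  - by apply/allP => _ /mapP[i + ->]; rewrite mem_filter => /andP[].
  - move=> w /MP[i [iM viM viw]]; apply/hasP; exists (v i) => //.
    by apply: map_f; rewrite mem_filter viM mem_index_iota.
apply/negP; rewrite -ltNge big_map big_filter.
rewrite -lte_fin; apply: (@le_lt_trans _ _ (\sum_(0 <= i < M)
    ((expR s)%:E * gauge s (U i) + (2^-1 ^+ i.+2)%:E))%E).
  rewrite -sumEFin [leRHS](bigID (fun i => size (v i) <= M)%N)/=.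
  apply: le_trans (leeDl _ _); first by apply: lee_sum => i _; exact: (vP i).2.
  apply: sume_ge0 => i _; apply: adde_ge0; last by rewrite lee_fin exprn_ge0.
  by rewrite mule_ge0 ?gauge_ge0// lee_fin expR_ge0.
rewrite big_split/= -ge0_sume_distrr; last by move=> i _; exact: gauge_ge0.
rewrite sumEFin.
rewrite [ltRHS](_ : 1%:E = (expR s)%:E * (expR (- s) / 2)%:E + 2^-1%:E)%E; last first.
  by rewrite -EFinM -EFinD mulrA -expRD subrr expR0; congr EFin; lra.
apply: lteD; last by rewrite lte_fin sum_half_pow.
rewrite lte_pmul2l ?lte_fin ?expR_gt0//; apply: le_lt_trans Us.
by apply: nneseries_lim_ge => i _ _; exact: gauge_ge0.
Qed.

End Bounds.

(** * Arithmetic of the claimed exponent *)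

Section GrowthExponent.
Context {R : realType} {n c : nat}.
Hypotheses (hn : (2 <= n)%N) (hc : (0 < c)%N).

(** Since [ln (1 - n ^- c)] is at most 0, the exponent times [c] is
    [ln (n ^ c) + ln (1 - n ^- c)]. *)
Lemma expR_growth_exponent :
  expR (ln n%:R - `|ln (1 - n%:R ^- c)| / c%:R) ^+ c = (n ^ c)%:R - 1 :> R.
Proof.
have n0 : 0 < (n%:R : R) by rewrite ltr0n; lia.
have nc1 : 1 < (n%:R : R) ^+ c by rewrite exprn_egt1 ?lt0n_neq0// ltr1n.
have nc0 : 0 < (n%:R : R) ^+ c by exact: lt_trans nc1.
have ncV : (n%:R : R) ^- c < 1 by rewrite invf_lt1.
rewrite -expRM_natr mulrBl mulfVK ?pnatr_eq0 ?lt0n_neq0//.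
rewrite ler0_norm; last by rewrite ln_le0// gerBl invr_ge0 ltW.
rewrite opprK expRD expRM_natr !lnK ?posrE// ?subr_gt0// natrX.
by rewrite mulrBr mulr1 divff// gt_eqF.
Qed.

(** Factoring [n ^ c - lam ^ c = 1] gives [n - lam] times [c] terms, each at most [n ^ c.-1]. The
    power [lam ^ (2 * c) = (n ^ c - 1) ^ 2] then outweighs [c * n ^ c.-1], whence the [2 * c]. *)
Lemma growth_gap (lam : R) m : 1 <= lam -> lam ^+ c = (n ^ c)%:R - 1 -> (2 * c <= m)%N ->
  1 <= (n%:R - lam) * lam ^+ m.
Proof.
move=> lam1 lamc cm; have lam0 : 0 < lam by exact: lt_le_trans lam1.
have lam_le : lam <= n%:R.
  by rewrite -(ler_pXn2r hc) ?nnegrE ?(ltW lam0) ?ler0n// lamc natrX gerBl.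
have gap : 1 <= (n%:R - lam) * (c * n ^ c.-1)%:R.
  have e1 : (n%:R : R) ^+ c - lam ^+ c = 1 by rewrite lamc natrX opprB addrC subrK.
  rewrite -[leLHS]e1 subrXX ler_wpM2l ?subr_ge0// natrM natrX mulr_natl.
  rewrite -[X in _ <= _ *+ X](card_ord c) -sumr_const; apply: ler_sum => i _.
  have ic : (i <= c.-1)%N by rewrite -ltnS prednK.
  rewrite -[in leRHS](subnK ic) exprD ler_wpM2l ?exprn_ge0//.
  by rewrite lerXn2r ?nnegrE ?ler0n ?(ltW lam0).
apply: le_trans gap _; rewrite ler_wpM2l ?subr_ge0//.
apply: (@le_trans _ _ (lam ^+ (2 * c))); last by rewrite ler_weXn2l.
have nc0 : (0 < n ^ c)%N by rewrite expn_gt0; lia.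
rewrite (mulnC 2) exprM lamc -(natrB _ nc0) -natrX ler_nat.
(* Thus [c * n ^ c.-1] is at most the square of [n ^ c.-1], and [n ^ c.-1 <= n ^ c - 1]. *)
have c_le : (c <= n ^ c.-1)%N by rewrite -[leqLHS](prednK hc) ltn_expl.
apply: leq_trans (leq_mul c_le (leqnn _)) _; rewrite mulnn leq_sqr.
have := leq_mul hn (leqnn (n ^ c.-1)); rewrite -expnS prednK//.
have : (0 < n ^ c.-1)%N by rewrite expn_gt0; lia.
by lia.
Qed.

End GrowthExponent.

(** * The two dimension bounds *)

Theorem theorem3p7 (R : realType) (n : nat) (hn : (2 <= n)%N)
  (wbar : word R n) (p : nat) (hp : (0 < p)%N)
  (hper : iter p word_shift wbar = wbar) (c : nat) (hc : (0 < c)%N) :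
  (hausdorff_dim (avoid_set wbar c) <=
     (ln n%:R - `|ln (1 - n%:R ^- c)| / c%:R)%:E)%E /\
  ((ln n%:R - `|ln (1 - n%:R ^- c)| / c%:R)%:E <=
     hausdorff_dim (avoid_set wbar (2 * c + p + 1)))%E.
Proof.
have := expR_growth_exponent (R := R) hn hc; set d := ln n%:R - _ => dP.
have nc2 : (2 <= n ^ c)%N by rewrite (leq_trans hn)// -[leqLHS]expn1 leq_pexp2l//; lia.
(* The infimum defining the dimension runs over nonnegative exponents only. *)
have d0 : 0 <= d.
  rewrite -ler_expR expR0 -(@ler_pXn2r _ c hc) ?nnegrE ?expR_ge0// dP expr1n.
  by rewrite lerBrDr -(natrD _ 1 1) ler_nat.
split.
  (* At exponent [d + e] the geometric ratio is below 1, as there are at most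
     [n ^ c - 1 = expR d ^+ c] blocks. *)
  apply/lee_addgt0Pr => e e0; rewrite -EFinD; apply: ereal_inf_lbound.
  exists (d + e) => //; split; first by rewrite addr_ge0// ltW.
  apply: hausdorff_measure_avoid_eq0 => //; first by rewrite addr_ge0// ltW.
  rewrite expRN exprVn ltr_pdivrMr ?exprn_gt0 ?expR_gt0// mul1r.
  apply: (@le_lt_trans _ _ (expR d ^+ c)).
    rewrite dP lerBrDr -(natrD _ _ 1) ler_nat addn1.
    by have := size_free_words_self (mkseq wbar c); rewrite size_mkseq card_ord.
  by rewrite ltrXn2r -?lt0n ?nnegrE ?expR_ge0// ltr_expR ltrDl.
(* An exponent [s < d] of measure zero is refuted with [lam = expR d], which exceeds 1 because
   [0 <= s < d]. *)
apply/ereal_infP => _ [s [s0 sA0] <-]; rewrite lee_fin leNgt; apply/negP => sd.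
apply: (hausdorff_measure_free_words_neq0 wbar (mkseq wbar (2 * c + p + 1)) s
  (expR d) _ _ _ _ _ _ _ sA0) => //.
- by rewrite addn1.
- by rewrite ler_expR ltW.
- by rewrite -expR0 ltr_expR (le_lt_trans s0).
- rewrite size_mkseq; apply: (growth_gap hn hc) => //; last by lia.
  by rewrite -expR0 ler_expR.
- by move=> w; exact: free_words_avoid.
Qed.
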